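(* Let $X$ be a metric space and let $K$ be a bounded metric space. Then the following conditions are equivalent: (a) $K$ is a large scale absolute extensor of $X$. (b) For every $\epsilon>0$ there is $\delta>0$ such that for any subset $A$ of $X$, every $(\delta,\delta)$-Lipschitz function $f\colon A\to K$ extends to an $(\epsilon,\epsilon)$-Lipschitz function $g\colon X\to K$.
   Context: A function $f\colon(X,d_X)\to(Y,d_Y)$ of metric spaces is $(\lambda,C)$-Lipschitz if $d_Y(f(x),f(x'))\le\lambda\, d_X(x,x')+C$ for all $x,x'\in X$. A function $f\colon X\to Y$ of metric spaces (not assumed continuous) is slowly oscillating if, for a base point $x_0\in X$ (whose choice is irrelevant), for all $R,\epsilon>0$ there is $N>0$ such that for every $x\in X$ with $d(x_0,x)>N$ the diameter of $f(B(x,R))$ is less than $\epsilon$. A metric space $K$ is a large scale absolute extensor of a metric space $X$ if for every subset $A\subset X$ and every slowly oscillating $f\colon A\to K$ there is a slowly oscillating $g\colon X\to K$ with $g|_A=f$. *)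

(* Defs.v *)
From HB Require Import structures.
From mathcomp Require Import all_boot all_order all_algebra.
From mathcomp Require Import all_classical all_reals all_analysis.

Set Implicit Arguments.
Unset Strict Implicit.
Unset Printing Implicit Defensive.

Import Order.TTheory GRing.Theory Num.Theory.

Local Open Scope classical_set_scope.
Local Open Scope ring_scope.

(* The library already equips the type of elements of A with the induced
   pseudometric structure; this adds the induced distance, so that a subset
   of a metric space is itself a metric space. *)
Section subset_metric.
Context {R : realType} {X : metricType R} (A : set X).

Let dist (x y : set_type A) : R := mdist (set_val x) (set_val y).

Let dist_ge0 x y : 0 <= dist x y. Proof. exact: mdist_ge0. Qed.

Let dist_positivity x y : dist x y = 0 -> x = y.
Proof. by move=> /mdist_positivity; exact: val_inj. Qed.

Let dist_ballE (x : set_type A) (d : R) : ball x d = [set y | dist x y < d].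
Proof. by rewrite -initial_ballE ballEmdist. Qed.

HB.instance Definition _ := @PseudoMetric_isMetric.Build R (set_type A)
  dist dist_ge0 dist_positivity dist_ballE.

End subset_metric.

Section large_scale.
Context {R : realType}.
Implicit Types X Y K : metricType R.

(* Not to be confused with the library's bounded sets, which need a norm. *)
Definition bounded_space X : Prop := exists M : R, forall x y : X, mdist x y <= M.

(* The supremum is in the extended reals: unbounded sets have diameter +oo.
   With this formula the empty set has diameter -oo rather than 0; below, the
   diameter is only taken of nonempty sets. *)
Definition diameter X (S : set X) : \bar R :=
  ereal_sup [set (mdist p.1 p.2)%:E | p in S `*` S].

(* (l, C)-Lipschitz *)
Definition ls_lipschitz X Y (l C : R) (f : X -> Y) : Prop :=
  forall x x' : X, mdist (f x) (f x') <= l * mdist x x' + C.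

(* As the choice of the base point is irrelevant, we quantify universally over
   it; in particular the map from the empty space is slowly oscillating. *)
Definition slowly_oscillating X Y (f : X -> Y) : Prop :=
  forall x0 : X, forall r e : R, 0 < r -> 0 < e ->
    exists2 N : R, 0 < N &
      forall x : X, N < mdist x0 x -> (diameter (f @` ball x r) < e%:E)%E.

Definition extends X Y (A : set X) (g : X -> Y) (f : A -> Y) : Prop :=
  forall a : A, g (set_val a) = f a.

Definition ls_absolute_extensor K X : Prop :=
  forall (A : set X) (f : A -> K), slowly_oscillating f ->
    exists2 g : X -> K, slowly_oscillating g & extends g f.

End large_scale.

(* Main.v *)
Require Import Defs.
From mathcomp Require Import all_boot all_order all_algebra.
From mathcomp Require Import all_classical all_reals all_analysis.
From mathcomp Require Import zify lra.
Import Order.TTheory GRing.Theory Num.Theory.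
Local Open Scope classical_set_scope.
Local Open Scope ring_scope.

(* Since K is bounded, say by M, an (e, e)-Lipschitz condition says nothing about
   pairs of points at distance at least M / e, so extensions of f over pieces of X
   that far apart can be glued without any compatibility.  Cut X into shells
   around a base point that are wide in this sense: extending first over the even
   shells and then over the odd ones costs only two applications of the local
   extension property.

   As K is bounded, f is slowly oscillating iff for every e > 0 it is
   (e, e)-Lipschitz on pairs meeting the complement of a large ball.
   (b) => (a): use ever thicker shells, with constants tending to 0.
   (a) => (b): first, the property in (b) holds uniformly on bounded sets outside
   a large ball; shells of constant width then give it outside that ball, and the
   ball itself is handled by constant extensions. *)

(** * Gluing local extensions of coarsely Lipschitz maps *)

Section coarse_extension.
Context {R : realType} {X K : metricType R}.
Set Implicit Arguments.
Unset Strict Implicit.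
Unset Printing Implicit Defensive.
Implicit Types (A D S T : set X) (f g : X -> K) (w : X -> R).

(** For constant weight [e] this is the [(e, e)]-Lipschitz condition on [A]. Since [x] and [y] may
    be exchanged, the smaller of [w x] and [w y] is the one that counts. *)
Definition coarse_lip w A f := forall x y, A x -> A y ->
  mdist (f x) (f y) <= w x * (mdist x y + 1).

Definition extendable (e d : R) T := forall A f, A `<=` T ->
  coarse_lip (cst d) A f ->
  exists2 g, {in A, g =1 f} & coarse_lip (cst e) T g.

Lemma mdist_add1_ge0 (x y : X) : 0 <= mdist x y + 1.
Proof. by rewrite addr_ge0// mdist_ge0. Qed.

Lemma coarse_lip_le w w' A f : (forall x, A x -> w x <= w' x) ->
  coarse_lip w A f -> coarse_lip w' A f.
Proof.
move=> ww' fA x y Ax Ay; apply: le_trans (fA _ _ Ax Ay) _.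
by rewrite ler_wpM2r ?mdist_add1_ge0 ?ww'.
Qed.

Lemma coarse_lip_sub w A B f : A `<=` B -> coarse_lip w B f -> coarse_lip w A f.
Proof. by move=> AB fB x y /AB Bx /AB; exact: fB. Qed.

Lemma extendable_sub e d S T : S `<=` T -> extendable e d T -> extendable e d S.
Proof.
move=> ST eT A f AS fA; have [g gf gT] := eT A f (subset_trans AS ST) fA.
by exists g => //; exact: coarse_lip_sub gT.
Qed.

Lemma extendable_le e d d' T : d' <= d -> extendable e d T -> extendable e d' T.
Proof.
move=> dd' eT A f AT fA; apply: eT => //.
exact: coarse_lip_le fA.
Qed.

(* A point of the piece [S i] lies in no [T j] with [j != i] and is far from
   everything outside [T i], so the local extensions need no compatibility. *)
Lemma glue_extensions (I : choiceType) (S T : I -> set X) (M : R) w A f :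
  (forall u v : K, mdist u v <= M) ->
  (forall i, S i `<=` T i) ->
  (forall i j x, S i x -> T j x -> i = j) ->
  (forall i x y, S i x -> (A `|` \bigcup_i S i) y -> ~ T i y ->
    M <= w x * (mdist x y + 1) /\ M <= w y * (mdist x y + 1)) ->
  (forall i, exists2 g, {in A `&` T i, g =1 f} & coarse_lip w (T i) g) ->
  coarse_lip w A f ->
  exists2 g, {in A, g =1 f} & coarse_lip w (A `|` \bigcup_i S i) g.
Proof.
move=> KM ST disj far loc fA.
have [G Gf] : {G : I -> X -> K & forall i,
    {in A `&` T i, G i =1 f} /\ coarse_lip w (T i) (G i)}.
  by apply: (@choice _ _ (fun i g => {in A `&` T i, g =1 f} /\
    coarse_lip w (T i) g)) => i; have [g] := loc i; exists g.
(* [g] is [f] on [A], [G i] on the rest of [S i], and an arbitrary default elsewhere. *)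
have [g gP] : {g : X -> K & forall x, (A x -> g x = f x) /\
    (forall i, ~ A x -> S i x -> g x = G i x)}.
  apply: (@choice _ _ (fun x u => (A x -> u = f x) /\
    (forall i, ~ A x -> S i x -> u = G i x))) => x.
  have [Ax|nAx] := pselect (A x); first by exists (f x).
  have [[i Six]|nSx] := pselect (exists i, S i x).
    exists (G i x); split=> // j _ Sjx.
    by rewrite (disj i j x Six (ST _ _ Sjx)).
  by exists (f x); split=> // i _ Six; case: nSx; exists i.
(* No other piece interferes on [T i]: a point of [S j] in [T i] has [j = i]. *)
have gT i x : T i x -> (A `|` \bigcup_i S i) x -> g x = G i x.
  move=> Tix; have [Ax _|nAx [//|[j _ Sjx]]] := pselect (A x).
    by rewrite (gP x).1// (Gf i).1// inE.
  by rewrite ((gP x).2 j)// (disj j i x).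
have step i x y : S i x -> (A `|` \bigcup_i S i) y ->
    mdist (g x) (g y) <= w x * (mdist x y + 1) /\
    mdist (g x) (g y) <= w y * (mdist x y + 1).
  move=> Six ASy; have [Tiy|nTiy] := pselect (T i y).
    have Tix := ST _ _ Six.
    rewrite !(gT i)//; last by right; exists i.
    by split; last rewrite metric_sym (metric_sym x); apply: (Gf i).2.
  have [h1 h2] := far i x y Six ASy nTiy.
  by split; [exact: le_trans (KM _ _) h1|exact: le_trans (KM _ _) h2].
exists g => [x|x y ASx ASy]; first by rewrite inE => /(gP x).1.
case: (ASx) => [Ax|[i _ Six]]; last exact: (step i x y Six ASy).1.
case: (ASy) => [Ay|[j _ Sjy]].
  by rewrite (gP x).1// (gP y).1//; exact: fA.
by rewrite metric_sym (metric_sym x); exact: (step j y x Sjy ASx).2.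
Qed.

(* [T k], the union of the shells [k.-1], [k], [k.+1], is the neighbourhood used to
   fill the shell [k]; hence the shifted constants [phi k.+1] and [psi k.-1], the
   smallest, resp. largest, ones over [T k]. *)
Lemma parity_extension (M : R) D (sh : X -> nat) (p : bool)
    (phi psi : nat -> R) A f :
  (forall u v : K, mdist u v <= M) ->
  (forall n, 0 <= phi n) ->
  (forall m n, (m <= n)%N -> phi n <= phi m) ->
  (forall n, psi n <= phi n) ->
  (forall m n, (m <= n)%N -> psi n <= psi m) ->
  (forall x y, D x -> D y -> ((sh x).+1 < sh y)%N -> M <= phi (sh y) * mdist x y) ->
  (forall k, extendable (phi k.+1) (psi k.-1)
     [set x | D x /\ (sh x <= k.+1)%N]) ->
  A `<=` D -> coarse_lip (psi \o sh) A f ->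
  exists2 g, {in A, g =1 f} &
    coarse_lip (phi \o sh) (A `|` [set x | D x /\ odd (sh x) = p]) g.
Proof.
move=> KM phi0 phi_anti psiphi psi_anti gap ext AD fA.
(* For [k] of the wrong parity both sets are empty. Distinct indices of equal parity differ by at
   least 2, so [S i] meets [T j] only if [i = j]. *)
pose S k := [set x | [/\ D x, sh x = k & odd k = p]].
pose T k := [set x | [/\ D x, (sh x <= k.+1)%N, (k <= (sh x).+1)%N & odd k = p]].
have -> : [set x | D x /\ odd (sh x) = p] = \bigcup_k S k.
  apply/seteqP; split => [x [Dx shx]|x [k _ [Dx <- ]]//].
  by exists (sh x).
apply: (@glue_extensions nat S T M) => //.
- by move=> k x [Dx <- op]; split => //=; lia.
- by move=> i j x [Dx <- oi] [_ h1 h2 oj]; move: h1 h2 oi oj; lia.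
- move=> i x y [Dx shx oi] ASy nTy.
  have Dy : D y by case: ASy => [/AD//|[j _ []]].
  (* Outside [T i] the shell index is off by at least 2, so [gap] applies in one order or the
     other. *)
  have : ((sh x).+1 < sh y)%N \/ ((sh y).+1 < sh x)%N.
    apply/orP; apply: contrapT => /negP; rewrite negb_or -!leqNgt => /andP[h1 h2].
    by apply: nTy; split => //; move: h1 h2; rewrite shx; lia.
  have ph n : phi n * mdist x y <= phi n * (mdist x y + 1).
    by rewrite ler_wpM2l// lerDl.
  move=> [lxy|lyx]; [have := gap x y Dx Dy lxy|have := gap y x Dy Dx lyx].
    move=> h; split; apply: (le_trans h); apply: le_trans (ph _) _ => //=.
    by rewrite ler_wpM2r ?mdist_add1_ge0// phi_anti//; lia.
  rewrite metric_sym => h; split; apply: (le_trans h); apply: le_trans (ph _) _ => //=.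
  by rewrite ler_wpM2r ?mdist_add1_ge0// phi_anti//; lia.
- move=> k; have [||g gf gT] := ext k (A `&` T k) f.
  + by move=> x [_ []].
  + apply: (@coarse_lip_le (psi \o sh)); last first.
      by apply: coarse_lip_sub fA => x [].
    by move=> x [_ [Dx h1 h2 _]]/=; apply: psi_anti; lia.
  exists g => //.
  apply: (@coarse_lip_le (cst (phi k.+1))).
    by move=> x [Dx h1 h2 _]/=; exact: phi_anti.
  by apply: coarse_lip_sub gT => x [].
- by apply: coarse_lip_le fA => x Ax /=.
Qed.

End coarse_extension.

(** * Extension over shells around a base point; from (b) to (a) *)

Section shells.
Context {R : realType} {X K : metricType R} (x0 : X) (M : R).
Hypothesis KM : forall u v : K, mdist u v <= M.
Set Implicit Arguments.
Unset Strict Implicit.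
Unset Printing Implicit Defensive.
Implicit Types (A D S T : set X) (f g : X -> K) (rho phi psi chi : nat -> R).

Lemma mdist_lipschitz (x y : X) : mdist x0 y - mdist x0 x <= mdist x y.
Proof. by rewrite lerBlDl metric_triangle. Qed.

Lemma radii_mono rho : (forall n, rho n + 1 <= rho n.+1) ->
  forall m n, (m <= n)%N -> rho m <= rho n.
Proof.
move=> rhoS m n; elim: n => [|n IH]; first by rewrite leqn0 => /eqP ->.
rewrite leq_eqVlt => /predU1P[->//|]; rewrite ltnS => /IH.
by have := rhoS n; lra.
Qed.

(** Radii growing by at least 1 are unbounded, so there is a least [n] with [t < rho n.+1]. Below
    [rho 0] the index 0 is a dummy. *)
Lemma radii_index rho : (forall n, rho n + 1 <= rho n.+1) ->
  {sh : R -> nat & forall t, rho 0 <= t -> rho (sh t) <= t < rho (sh t).+1}.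
Proof.
move=> rhoS.
have rho_ge n : rho 0 + n%:R <= rho n.
  elim: n => [|n IH]; first by rewrite addr0.
  by have := rhoS n; rewrite -natr1; lra.
apply: (@choice _ _ (fun t n => rho 0 <= t -> rho n <= t < rho n.+1)) => t.
have [t0|] := leP (rho 0) t; last by exists 0%N.
have ex : exists n, t < rho n.+1.
  exists (Num.truncn (t - rho 0)).
  have := truncnS_gt (t - rho 0).
  by have := rho_ge (Num.truncn (t - rho 0)).+1; lra.
case: (ex_minnP ex) => n tn nmin; exists n => _; rewrite tn andbT.
case: n nmin tn => [//|n] nmin _; rewrite leNgt; apply/negP => /nmin.
by rewrite ltnn.
Qed.

Definition shell_lip rho phi A f := forall n x y, A x -> A y ->
  rho n <= mdist x0 x -> mdist (f x) (f y) <= phi n * (mdist x y + 1).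

(** Two passes of [parity_extension]: the constants degrade from [chi] to [psi] over the even
    shells, then from [psi] to [phi] over the odd ones. *)
Lemma shell_extension rho phi psi chi A f :
  (forall n, rho n + 1 <= rho n.+1) ->
  (forall n, 0 <= chi n) -> (forall n, chi n <= psi n) ->
  (forall n, psi n <= phi n) ->
  (forall m n, (m <= n)%N -> phi n <= phi m) ->
  (forall m n, (m <= n)%N -> psi n <= psi m) ->
  (forall m n, (m <= n)%N -> chi n <= chi m) ->
  (forall n, M <= chi n.+1 * (rho n.+1 - rho n)) ->
  (forall k, extendable (K := K) (phi k.+1) (psi k.-1)
    [set x | rho 0 <= mdist x0 x < rho k.+2]) ->
  (forall k, extendable (K := K) (psi k.+1) (chi k.-1)
    [set x | rho 0 <= mdist x0 x < rho k.+2]) ->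
  A `<=` [set x | rho 0 <= mdist x0 x] -> shell_lip rho chi A f ->
  exists2 g, {in A, g =1 f} &
    shell_lip rho phi [set x | rho 0 <= mdist x0 x] g.
Proof.
move=> rhoS chi0 chipsi psiphi phi_anti psi_anti chi_anti gap ext1 ext2 AD fA.
have [idx idxP] := radii_index rhoS.
have rho_mono := radii_mono rhoS.
set D := [set x | _]; pose sh x := idx (mdist x0 x).
have shP x : D x -> rho (sh x) <= mdist x0 x < rho (sh x).+1.
  by move=> Dx; exact: idxP.
have psi0 n : 0 <= psi n by apply: le_trans (chipsi n).
have phi0 n : 0 <= phi n by apply: le_trans (psiphi n).
(* The whole shell just below that of [y] separates the two points, and [gap] bounds its width from
   below. *)
have gap' x y : D x -> D y -> ((sh x).+1 < sh y)%N ->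
    M <= chi (sh y) * mdist x y.
  move=> Dx Dy; case E : (sh y) => [//|n]; rewrite ltnS => xn.
  apply: le_trans (gap n) _; apply: ler_wpM2l => //.
  apply: le_trans (mdist_lipschitz x y).
  have /andP[_ h1] := shP x Dx; have /andP[h2 _] := shP y Dy.
  have := rho_mono _ _ xn; rewrite E in h2; lra.
have subT k : [set x | D x /\ (sh x <= k.+1)%N] `<=`
    [set x | rho 0 <= mdist x0 x < rho k.+2].
  move=> x [Dx shx] /=; have /andP[_ h] := shP x Dx.
  by rewrite (Dx : rho 0 <= _)/=; apply: lt_le_trans h _; exact: rho_mono.
have fA' : coarse_lip (chi \o sh) A f.
  by move=> x y Ax Ay; apply: fA => //; have /andP[] := shP x (AD x Ax).
have [|||g1 g1f g1A] := parity_extension (D := D) (sh := sh) false KM psi0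
    psi_anti chipsi chi_anti _ _ _ fA'.
- move=> x y Dx Dy xy; apply: (le_trans (gap' x y Dx Dy xy)).
  by rewrite ler_wpM2r ?mdist_ge0.
- by move=> k; apply: extendable_sub (ext2 k); exact: subT.
- exact: AD.
have [|||g2 g2f g2A] := parity_extension (D := D) (sh := sh) true KM phi0 phi_anti
    psiphi psi_anti _ _ _ g1A.
- move=> x y Dx Dy xy; apply: (le_trans (gap' x y Dx Dy xy)).
  by rewrite ler_wpM2r ?mdist_ge0//; exact: le_trans (chipsi _) (psiphi _).
- by move=> k; apply: extendable_sub (ext1 k); exact: subT.
- by move=> x [/AD//|[]].
exists g2 => [x xA|n x y Dx Dy nx].
  by rewrite g2f ?g1f//; move: xA; rewrite !inE; left.
have all z : D z -> ((A `|` [set x | D x /\ odd (sh x) = false]) `|`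
    [set x | D x /\ odd (sh x) = true]) z.
  by move=> Dz; case: (boolP (odd (sh z))) => oz;
    [right|left; right]; split => //; exact/negbTE.
apply: le_trans (g2A x y (all x Dx) (all y Dy)) _.
rewrite ler_wpM2r ?mdist_add1_ge0//=; apply: phi_anti.
rewrite leqNgt; apply/negP => lt; have := rho_mono _ _ lt.
by have /andP[_] := shP x Dx; lra.
Qed.

Definition tail_lip A f := forall e : R, 0 < e -> exists N : R, forall x y,
  A x -> A y -> N < mdist x0 x -> mdist (f x) (f y) <= e * (mdist x y + 1).

Lemma antitone_chain phi :
  (forall e : R, 0 < e -> exists2 d : R, 0 < d & extendable e d [set: X] (K:=K)) ->
  (forall n, 0 < phi n) ->
  exists psi, [/\ forall n, 0 < psi n, forall n, psi n <= phi n,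
    forall m n, (m <= n)%N -> psi n <= psi m &
    forall k T, extendable (phi k.+1) (psi k.-1) T (K:=K)].
Proof.
move=> ext phi0.
have [del delP] : {del : R -> R & forall e, 0 < e ->
    0 < del e /\ extendable e (del e) [set: X] (K := K)}.
  apply: (@choice _ _ (fun e d => 0 < e -> 0 < d /\ extendable e d [set: X])).
  move=> e; have [/ext[d d0 ed]|_] := ltP 0 e; last by exists 0.
  by exists d.
(* [psi n] must serve every [k] with [k.-1 = n]: this involves [phi n.+2] and, for [n = 0], also
   [phi 1]. *)
pose psi := fix psi n := if n is m.+1 then
    Num.min (psi m) (Num.min (phi m.+1) (del (phi m.+3)))
  else Num.min (phi 0%N) (Num.min (del (phi 1%N)) (del (phi 2%N))).
have del0 n : 0 < del (phi n) by have [] := delP _ (phi0 n).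
have psiS n : psi n.+1 <= psi n by rewrite /= ge_min lexx.
have psi_anti m n : (m <= n)%N -> psi n <= psi m.
  elim: n => [|n IH]; first by rewrite leqn0 => /eqP ->.
  by rewrite leq_eqVlt => /predU1P[->//|]; rewrite ltnS => /IH; exact: le_trans.
exists psi; split=> //.
- by elim=> [|n IH]; rewrite /= !lt_min !phi0 !del0// IH.
- by case=> [|n] /=; rewrite !ge_min lexx ?orbT.
- move=> k T; apply: (@extendable_sub _ _ _ _ _ _ [set: X]) => //.
  apply: (@extendable_le _ _ _ _ (del (phi k.+1))); last by have [] := delP _ (phi0 k.+1).
  by case: k => [|[|k]] /=; rewrite !ge_min lexx ?orbT.
Qed.

(** The constants are chosen backwards: [phi] tends to 0, [psi] is what the odd pass needs to reach
    [phi], and [chi] what the even pass needs to reach [psi]. *)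
Lemma tail_lip_extension A f :
  (forall e : R, 0 < e -> exists2 d : R, 0 < d & extendable e d [set: X] (K:=K)) ->
  tail_lip A f -> exists2 g, {in A, g =1 f} & tail_lip [set: X] g.
Proof.
move=> ext fA.
have M0 : 0 <= M by apply: le_trans (KM (f x0) (f x0)); exact: mdist_ge0.
pose phi n : R := n.+1%:R^-1.
have phi0 n : 0 < phi n by rewrite invr_gt0.
have phi_anti m n : (m <= n)%N -> phi n <= phi m.
  by move=> mn; rewrite lef_pV2 ?posrE// ler_nat.
have [psi [psi0 psiphi psi_anti ext1]] := antitone_chain ext phi0.
have [chi [chi0 chipsi chi_anti ext2]] := antitone_chain ext psi0.
have [N NP] : {N : nat -> R & forall n x y, A x -> A y -> N n < mdist x0 x ->
    mdist (f x) (f y) <= chi n * (mdist x y + 1)}.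
  by apply: (@choice _ _ (fun n N => forall x y, A x -> A y -> N < mdist x0 x ->
    mdist (f x) (f y) <= chi n * (mdist x y + 1))) => n; exact: fA.
(* Passing [N n] makes [chi n] valid for [f] beyond [rho n]; the summand [M / chi m.+1] makes the
   shell wide enough. *)
pose rho := fix rho n := if n is m.+1 then
  Num.max (rho m) (N m.+1) + 1 + M / chi m.+1 else N 0%N + 1.
have Mchi n : 0 <= M / chi n by rewrite divr_ge0// ltW.
have rhoS n : rho n + 1 <= rho n.+1.
  have : rho n <= Num.max (rho n) (N n.+1) by rewrite le_max lexx.
  by have := Mchi n.+1; rewrite /=; lra.
have rhoN n : N n < rho n.
  case: n => [|n] /=; first lra.
  have : N n.+1 <= Num.max (rho n) (N n.+1) by rewrite le_max lexx orbT.
  by have := Mchi n.+1; lra.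
have rho_mono := radii_mono rhoS.
set D := [set x | rho 0 <= mdist x0 x].
have [||||||g gf gD] := @shell_extension rho phi psi chi (A `&` D) f rhoS
  _ chipsi psiphi phi_anti psi_anti chi_anti _ _ _ _ _.
- by move=> n; exact: ltW.
- move=> n; rewrite mulrC -ler_pdivrMr//=.
  have : rho n <= Num.max (rho n) (N n.+1) by rewrite le_max lexx.
  by lra.
- by move=> k; exact: ext1.
- by move=> k; exact: ext2.
- by move=> x [].
- move=> n x y [Ax _] [Ay _] nx; apply: NP => //.
  exact: lt_le_trans (rhoN n) nx.
(* [g] is known to agree with [f] only on [D], so [f] is restored on the part of [A] inside the ball
   of radius [rho 0]. *)
pose h x := if x \in A then f x else g x.
have hg x : D x -> h x = g x.
  move=> Dx; rewrite /h; case: ifPn => // xA; rewrite gf// inE; split=> //.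
  by rewrite inE in xA.
exists h => [x xA|e e0]; first by rewrite /h xA.
pose n := Num.truncn e^-1.
have ne : phi n <= e.
  rewrite /phi -[leRHS]invrK lef_pV2 ?posrE ?invr_gt0//.
  exact/ltW/truncnS_gt.
have Me0 : 0 <= M / e by rewrite divr_ge0// ltW.
(* Past [rho n] the constant is [phi n <= e]; the second bound keeps [x] at distance at least
   [M / e] from any [y] outside [D], where boundedness of [K] suffices. *)
exists (Num.max (rho n) (rho 0%N + M / e)) => x y _ _.
rewrite gt_max => /andP[xn xe].
have Dx : rho 0 <= mdist x0 x by lra.
have [Dy|nDy] := pselect (D y).
  rewrite !hg//; apply: le_trans (gD n x y Dx Dy (ltW xn)) _.
  by rewrite ler_wpM2r ?mdist_add1_ge0.
apply: (le_trans (KM _ _)); rewrite mulrC -ler_pdivrMr//.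
have : mdist x0 y < rho 0%N by rewrite ltNge; apply/negP.
have := mdist_lipschitz y x; rewrite (metric_sym y x); lra.
Qed.

End shells.

(** * Uniform constants for extension; from (a) to (b) *)

Section uniform_extension.
Context {R : realType} {X K : metricType R} (x0 : X) (M : R).
Hypothesis KM : forall u v : K, mdist u v <= M.
Hypothesis M0 : 0 <= M.
Set Implicit Arguments.
Unset Strict Implicit.
Unset Printing Implicit Defensive.
Implicit Types (A D S T : set X) (f g : X -> K).

(** The one-piece case of gluing, for enlarging a domain by a single set. *)
Lemma glue_extension (e d : R) S T A f :
  0 <= e -> d <= e -> S `<=` T ->
  (forall x y, S x -> ~ T y -> M <= e * mdist x y) ->
  extendable e d T (K := K) -> coarse_lip (cst d) A f ->
  exists2 g, {in A, g =1 f} & coarse_lip (cst e) (A `|` S) g.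
Proof.
move=> e0 de ST far ext fA.
rewrite -(bigcup_const S (ltac:(by exists tt) : [set: unit] !=set0)).
apply: (@glue_extensions _ _ _ unit (fun=> S) (fun=> T) M) => //=.
- by move=> [] [].
- move=> _ x y Sx _ nTy; have := far x y Sx nTy.
  by rewrite mulrDr mulr1; split; lra.
- move=> _; apply: ext => [x []//|].
  by apply: coarse_lip_sub fA => x [].
- exact: coarse_lip_le fA.
Qed.

(** Distances in the ball are at most [2 * s], so [f] varies by at most [e] on [A], and any one of
    its values serves off [A]. *)
Lemma extendable_bounded (e s : R) T : 0 < e -> 0 <= s ->
  T `<=` [set x | mdist x0 x <= s] -> extendable e (e / (2 * s + 1)) T (K := K).
Proof.
move=> e0 s0 Ts A f AT fA.
have fs x y : A x -> A y -> mdist (f x) (f y) <= e.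
  move=> Ax Ay; apply: (le_trans (fA x y Ax Ay)) => /=.
  rewrite -mulrA ler_piMr ?(ltW e0)// mulrC ler_pdivrMr; last lra.
  have /= := Ts _ (AT _ Ax); have /= := Ts _ (AT _ Ay).
  by have := metric_triangle x x0 y; rewrite (metric_sym x x0); lra.
have le_e (x y : X) : e <= e * (mdist x y + 1).
  by rewrite ler_peMr ?(ltW e0)// lerDr mdist_ge0.
have [[a Aa]|nA] := pselect (A !=set0).
  exists (fun x => if x \in A then f x else f a) => [x ->//|x y _ _ /=].
  apply: le_trans (le_e x y).
  by case: ifPn => xA; case: ifPn => yA; apply: fs => //; exact: set_mem.
exists (cst (f x0)) => [x|x y _ _ /=].
  by rewrite inE => Ax; case: nA; exists x.
by rewrite mdistxx; apply: le_trans (le_e x y); exact: ltW.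
Qed.

(* If this failed, then ever farther apart bounded sets carrying functions with
   ever smaller constants and no extension would assemble into one slowly
   oscillating function, whose extension is good on all but finitely many. *)
Lemma extendable_far_bounded (e : R) :
  (forall A f, tail_lip x0 A f ->
     exists2 g, {in A, g =1 f} & tail_lip x0 [set: X] g) ->
  0 < e -> exists d r : R, 0 < d /\ forall s : R,
    extendable e d [set x | r <= mdist x0 x <= s] (K := K).
Proof.
move=> ext e0; apply: contrapT => nex.
(* A counterexample for each scale [p.1] and inner radius [p.2]: [q.1.1] is its domain, [q.1.2] the
   map, [q.2] the outer radius. *)
have bad (p : nat * R) : exists q : set X * (X -> K) * R,
    [/\ p.2 <= q.2,
      q.1.1 `<=` [set x | p.2 <= mdist x0 x <= q.2],
      coarse_lip (cst p.1.+1%:R^-1) q.1.1 q.1.2 &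
      forall g, {in q.1.1, g =1 q.1.2} ->
        ~ coarse_lip (cst e) [set x | p.2 <= mdist x0 x <= q.2] g].
  case: p => n r /=; apply: contrapT => nq; apply: nex.
  exists n.+1%:R^-1, r; split; first by rewrite invr_gt0.
  move=> s A f As fA; apply: contrapT => ng; apply: nq.
  exists (A, f, Num.max r s); split => //=.
  - by rewrite le_max lexx.
  - by move=> x /As /= /andP[-> h]; rewrite le_max h orbT.
  - move=> g gf gT; apply: ng; exists g => //.
    apply: coarse_lip_sub gT => x /= /andP[-> h].
    by rewrite le_max h orbT.
have {bad} [Q QP] := choice bad.
(* Counterexamples go into successive annuli, with a gap above [M * n.+1] before annulus [n]. Points
   of different annuli then satisfy the estimate with constant [n.+1%:R^-1], [n] being the larger
   index. *)
pose lo := fix lo n : R :=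
  if n is m.+1 then (Q (m, lo m)).2 + M * m.+2%:R + 1 else 0.
pose hi n := (Q (n, lo n)).2.
pose A n := (Q (n, lo n)).1.1; pose F n := (Q (n, lo n)).1.2.
have lohi n : lo n <= hi n by have [] := QP (n, lo n).
have AP n x : A n x -> lo n <= mdist x0 x <= hi n.
  by have [_ h _ _] := QP (n, lo n); exact: h.
have FP n : coarse_lip (cst n.+1%:R^-1) (A n) (F n) by have [] := QP (n, lo n).
have loS n : hi n + M * n.+2%:R + 1 = lo n.+1 by [].
have Mn n : 0 <= M * n%:R by rewrite mulr_ge0.
have lo_mono := @radii_mono _ lo (ltac:(move=> n; rewrite -loS;
  have := lohi n; have := Mn n.+2; lra)).
have lo_ge n : n%:R <= lo n.
  elim: n => [//|n IH]; rewrite -loS -natr1.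
  by have := lohi n; have := Mn n.+2; lra.
have sep m n : (m < n)%N -> hi m + M * n.+1%:R + 1 <= lo n.
  case: n => [//|n]; rewrite ltnS -loS => mn.
  rewrite -!addrA lerD2r.
  move: mn; rewrite leq_eqVlt => /predU1P[->//|mn].
  apply: le_trans (lohi n); apply: le_trans (lo_mono _ _ mn).
  by rewrite -loS; have := Mn m.+2; lra.
have Adisj m n x : A m x -> A n x -> m = n.
  wlog mn : m n / (m <= n)%N => [wl Amx Anx|/AP/andP[_ mx] /AP/andP[nx _]].
    by case: (leqP m n) => [|/ltnW] mn; [exact: wl|symmetry; exact: wl].
  move: mn; rewrite leq_eqVlt => /predU1P[//|/sep mn]; exfalso.
  by have := Mn n.+1; lra.
have [f fP] : {f : X -> K & forall x n, A n x -> f x = F n x}.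
  apply: (@choice _ _ (fun x u => forall n, A n x -> u = F n x)) => x.
  have [[m Am]|nA] := pselect (exists m, A m x).
    by exists (F m x) => n An; rewrite (Adisj m n x).
  by exists (F 0%N x) => n An; case: nA; exists n.
have [|g gf gX] := ext (\bigcup_n A n) f.
  (* Beyond [hi n0] only annuli of index above [n0] remain, and their constants are at most [t]. *)
  move=> t t0; pose n0 := Num.truncn t^-1.
  have tn n : (n0 <= n)%N -> 1 <= t * n.+1%:R.
    move=> n0n; rewrite mulrC -ler_pdivrMr// div1r.
    by apply: le_trans (ltW (truncnS_gt _)) _; rewrite ler_nat.
  exists (hi n0) => x y [n _ Anx] [m _ Amy] lt.
  have n0n : (n0 < n)%N.
    have /andP[_ nx] := AP _ _ Anx.
    rewrite ltnNge leq_eqVlt; apply/negP => /predU1P[nn|/sep].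
      by move: nx; rewrite nn; lra.
    by have := Mn n0.+1; have := lohi n0; lra.
  have far k : (n0 <= k)%N -> M * k.+1%:R <= mdist x y ->
      mdist (f x) (f y) <= t * (mdist x y + 1).
    move=> n0k kxy; apply: (le_trans (KM _ _)).
    apply: (@le_trans _ _ (t * (M * k.+1%:R))).
      by rewrite mulrCA ler_peMr// tn.
    by rewrite ler_wpM2l ?(ltW t0)//; lra.
  case: (ltngtP n m) => [nm|mn|nm].
  - apply: (far m); first by rewrite ltnW// (ltn_trans n0n).
    have := sep _ _ nm; have /andP[_] := AP _ _ Anx.
    by have /andP[] := AP _ _ Amy; have := mdist_lipschitz x0 x y; lra.
  - apply: (far n); first exact: ltnW.
    have := sep _ _ mn; have /andP[] := AP _ _ Anx; have /andP[_] := AP _ _ Amy.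
    by have := mdist_lipschitz x0 y x; rewrite (metric_sym y x); lra.
  - rewrite -nm in Amy.
    rewrite (fP _ _ Anx) (fP _ _ Amy); apply: (le_trans (FP n _ _ Anx Amy)) => /=.
    rewrite ler_wpM2r ?mdist_add1_ge0// -[leLHS]mulr1 ler_pdivrMl//.
    by rewrite mulrC tn// ltnW.
have [N NP] := gX e e0.
(* Annulus [n] lies entirely beyond [N], so [g] extends there a map chosen to have no such
   extension. *)
pose n := (Num.truncn N).+1.
have Nlo : N < lo n by apply: lt_le_trans (lo_ge n); exact: truncnS_gt.
have [_ _ _ /(_ g)] := QP (n, lo n); apply.
  move=> x; rewrite inE => Ax; transitivity (f x); last exact: fP.
  by apply: gf; rewrite inE; exists n.
move=> x y /= /andP[nx _] _; apply: NP => //.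
exact: lt_le_trans nx.
Qed.

(** First extend over the ball of radius [r + L], then over the rest by shells. Each time the local
    extension is made on a set larger by a margin [L], which suffices for gluing. *)
Lemma extendable_setT (e : R) :
  (forall A f, tail_lip x0 A f ->
     exists2 g, {in A, g =1 f} & tail_lip x0 [set: X] g) ->
  0 < e -> exists2 d : R, 0 < d & extendable e d [set: X] (K := K).
Proof.
move=> ext e0.
(* Two rounds, for the two passes of [shell_extension]; the minima keep [d2 <= d1 <= e]. *)
have [d1' [r1 [d1'0 ext1']]] := extendable_far_bounded ext e0.
pose d1 := Num.min d1' e.
have d10 : 0 < d1 by rewrite lt_min d1'0.
have d1e : d1 <= e by rewrite ge_min lexx orbT.
have ext1 s : extendable e d1 [set x | r1 <= mdist x0 x <= s] (K := K).
  by apply: extendable_le (ext1' s); rewrite ge_min lexx.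
have [d2' [r2 [d2'0 ext2']]] := extendable_far_bounded ext d10.
pose d2 := Num.min d2' d1.
have d20 : 0 < d2 by rewrite lt_min d2'0.
have d21 : d2 <= d1 by rewrite ge_min lexx orbT.
have ext2 s : extendable d1 d2 [set x | r2 <= mdist x0 x <= s] (K := K).
  by apply: extendable_le (ext2' s); rewrite ge_min lexx.
(* [L] is chosen for [M <= d2 * L] and serves both as shell width and as margin. *)
pose r := Num.max 0 (Num.max r1 r2); pose L := M / d2 + 1.
have r0 : 0 <= r by rewrite /r le_max lexx.
have r1r : r1 <= r by rewrite /r !le_max lexx orbT.
have r2r : r2 <= r by rewrite /r !le_max lexx !orbT.
have Md2 : 0 <= M / d2 by rewrite divr_ge0// ltW.
have L1 : 1 <= L by rewrite /L; lra.
have ML : M <= d2 * L by rewrite /L mulrDr mulr1 mulrCA mulfV ?gt_eqF// mulr1; lra.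
pose rho n : R := r + n%:R * L.
have rhoS n : rho n.+1 = rho n + L by rewrite /rho -natr1; lra.
have rho_mono := @radii_mono _ rho (ltac:(move=> n; rewrite rhoS; lra)).
have rho0 : rho 0 = r by rewrite /rho mul0r addr0.
have ext_far : extendable e d2 [set x | rho 0 <= mdist x0 x] (K := K).
  move=> A f AD fA.
  have [|||||||||||g gf gD] := @shell_extension _ _ _ x0 _ KM rho (cst e)
      (cst d1) (cst d2) A f _ _ _ _ _ _ _ _ _ _ AD.
  - by move=> n; rewrite rhoS; lra.
  - by move=> n; exact: ltW.
  - by [].
  - by [].
  - by [].
  - by [].
  - by [].
  - by move=> n /=; rewrite rhoS addrAC subrr add0r.
  - move=> k; apply: extendable_sub (ext1 (rho k.+2)) => x /= /andP[h1 h2].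
    by rewrite (ltW h2) (le_trans r1r)// -rho0.
  - move=> k; apply: extendable_sub (ext2 (rho k.+2)) => x /= /andP[h1 h2].
    by rewrite (ltW h2) (le_trans r2r)// -rho0.
  - by move=> n x y Ax Ay _; exact: fA.
  by exists g => // x y Dx Dy; apply: (gD 0%N).
pose s := r + 2 * L; pose d := d2 / (2 * s + 1).
have s0 : 0 <= s by rewrite /s; lra.
have dd2 : d <= d2 by rewrite ler_pdivrMr ?ler_peMr ?(ltW d20)//; lra.
exists d; first by rewrite divr_gt0//; lra.
move=> A f _ fA.
have [|||g1 g1f g1A] := @glue_extension d2 d [set x | mdist x0 x <= r + L]
    [set x | mdist x0 x <= s] A f (ltW d20) dd2 _ _ _ fA.
- by move=> x /=; rewrite /s; lra.
- move=> x y /= xr /negP; rewrite -ltNge => sy; apply: (le_trans ML).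
  rewrite ler_wpM2l ?(ltW d20)//; have := mdist_lipschitz x0 x y.
  by move: sy; rewrite /s; lra.
- exact: extendable_bounded.
have [||g2 g2f g2A] := @glue_extension e d2 [set x | r + L <= mdist x0 x]
    [set x | rho 0 <= mdist x0 x] _ _ (ltW e0) (le_trans d21 d1e) _ _ ext_far g1A.
- by move=> x /=; rewrite rho0; lra.
- move=> x y /= xr /negP; rewrite -ltNge rho0 => sy; apply: (le_trans ML).
  apply: ler_pM => //; [exact: ltW|lra|exact: le_trans d1e|].
  by have := mdist_lipschitz x0 y x; rewrite (metric_sym y x); lra.
exists g2.
  by move=> x xA; rewrite g2f ?g1f//; move: xA; rewrite !inE; left.
apply: coarse_lip_sub g2A => x _.
by have [|] := leP (mdist x0 x) (r + L) => h; [left; right|right; exact: ltW].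
Qed.

End uniform_extension.

(** * Slow oscillation as a tail estimate; maps on subsets as restrictions *)

Section slow_oscillation.
Context {R : realType} {X K : metricType R} (M : R).
Hypothesis KM : forall u v : K, mdist u v <= M.
Hypothesis M0 : 0 <= M.
Set Implicit Arguments.
Unset Strict Implicit.
Unset Printing Implicit Defensive.

(** Pairs at distance at least [M / e + 1] satisfy the tail estimate by boundedness; closer ones lie
    in a ball whose image has small diameter. *)
Lemma slowly_oscillatingP (Y : metricType R) (f : Y -> K) :
  slowly_oscillating f <-> forall y0, tail_lip y0 [set: Y] f.
Proof.
split=> [fso y0 e e0|fT y0 r e r0 e0].
  have r0 : 0 < M / e + 1 by rewrite ltr_wpDl// divr_ge0// ltW.
  have [N _ NP] := fso y0 _ _ r0 e0; exists N => x y _ _ /NP diam.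
  have [xy|yx] := ltP (mdist x y) (M / e + 1); last first.
    apply: (le_trans (KM _ _)); rewrite mulrC -ler_pdivrMr//; lra.
  apply: (@le_trans _ _ e); last by rewrite ler_peMr ?(ltW e0)// lerDr mdist_ge0.
  rewrite -lee_fin; apply: le_trans (ltW diam); apply: ereal_sup_ubound.
  exists (f x, f y) => //; split => /=; [exists x|exists y] => //;
    rewrite ballEmdist//=.
  by rewrite mdistxx.
(* With this constant the ball maps within [e / 4] of [f x], so the diameter is at most [e / 2],
   strictly below [e]. *)
have c0 : 0 < e / (4 * (r + 1)) by rewrite divr_gt0// mulr_gt0//; lra.
have [N NP] := fT y0 _ c0; exists (Num.max N 1); first by rewrite lt_max ltr01 orbT.
move=> x; rewrite gt_max => /andP[Nx _].
apply: (@le_lt_trans _ _ (e / 2)%:E); last by rewrite lte_fin; lra.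
have near y : ball x r y -> mdist (f x) (f y) <= e / 4.
  rewrite ballEmdist /= => xy; apply: le_trans (NP x y I I Nx) _.
  rewrite invfM mulrA -mulrA ler_piMr//; first by rewrite divr_ge0// ltW.
  by rewrite mulrC ler_pdivrMr; lra.
apply: ge_ereal_sup => _ [[_ _] [[y xy <-] [z xz <-]] <-] /=.
rewrite lee_fin; have := metric_triangle (f y) (f x) (f z).
have := near y xy; have := near z xz; rewrite (metric_sym (f y) (f x)); lra.
Qed.

Lemma tail_lip_basepoint (x0 x1 : X) (A : set X) (f : X -> K) :
  tail_lip x0 A f -> tail_lip x1 A f.
Proof.
move=> fA e e0; have [N NP] := fA e e0; exists (N + mdist x0 x1) => x y Ax Ay xN.
by apply: NP => //; have := metric_triangle x1 x0 x; rewrite (metric_sym x1 x0); lra.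
Qed.

(** Base points of the subspace lie in [A] but [x0] need not; [tail_lip_basepoint] bridges this, and
    an empty [A] is vacuous. *)
Lemma slowly_oscillating_restrict (x0 : X) (A : set X) (f : X -> K) :
  slowly_oscillating (fun a : A => f (set_val a)) <-> tail_lip x0 A f.
Proof.
rewrite slowly_oscillatingP; split=> [fA|fA a e e0].
  have [[a Aa]|nA] := pselect (A !=set0); last first.
    by move=> e _; exists 0 => x y Ax; case: nA; exists x.
  apply: (@tail_lip_basepoint a) => e e0.
  have [N NP] := fA (SigSub (mem_set Aa)) e e0; exists N => x y Ax Ay xN.
  exact: (NP (SigSub (mem_set Ax)) (SigSub (mem_set Ay)) I I xN).
have [N NP] := tail_lip_basepoint (set_val a) fA e0; exists N => x y _ _.
by apply: NP; exact: set_valP.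
Qed.

Lemma slowly_oscillating_tail_lip (x0 : X) (f : X -> K) :
  slowly_oscillating f <-> tail_lip x0 [set: X] f.
Proof.
rewrite slowly_oscillatingP; split=> [//|fX x1].
exact: tail_lip_basepoint fX.
Qed.

Lemma total_extension (u : K) (A : set X) (f : A -> K) :
  exists F : X -> K, f = fun a => F (set_val a).
Proof.
exists (fun x => if pselect (A x) is left Ax then f (SigSub (mem_set Ax)) else u).
apply/funext => a; case: pselect => [Aa|]; last by case; exact: set_valP.
by congr f; exact: val_inj.
Qed.

Lemma extends_restrict (A : set X) (f g : X -> K) :
  @extends R X K A g (fun a => f (set_val a)) <-> {in A, g =1 f}.
Proof.
split=> [gf x xA|gf a]; first exact: (gf (SigSub xA)).
by apply: gf; rewrite inE; exact: set_valP.
Qed.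

Lemma ls_lipschitz_restrict (e : R) (A : set X) (f : X -> K) :
  ls_lipschitz e e (fun a : A => f (set_val a)) <-> coarse_lip (cst e) A f.
Proof.
split=> [fA x y Ax Ay|fA x y].
  have := fA (SigSub (mem_set Ax)) (SigSub (mem_set Ay)).
  by rewrite /= mulrDr mulr1.
by rewrite -{2}(mulr1 e) -mulrDr; apply: fA; exact: set_valP.
Qed.

Lemma ls_lipschitz_setT (e : R) (f : X -> K) :
  ls_lipschitz e e f <-> coarse_lip (cst e) [set: X] f.
Proof.
split=> [fX x y _ _|fX x y]; first by rewrite /= mulrDr mulr1.
by rewrite -{2}(mulr1 e) -mulrDr; exact: fX.
Qed.

Lemma ls_absolute_extensorP (x0 : X) (u : K) :
  ls_absolute_extensor K X <-> forall (A : set X) (f : X -> K),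
    tail_lip x0 A f -> exists2 g, {in A, g =1 f} & tail_lip x0 [set: X] g.
Proof.
split=> [KX A f fA|KX A f].
  have [g gso gf] := KX A _ ((slowly_oscillating_restrict x0 A f).2 fA).
  exists g; first exact/extends_restrict.
  exact/slowly_oscillating_tail_lip.
have [F ->] := total_extension u f.
move=> /(slowly_oscillating_restrict x0)/KX[g gF gX].
exists g; last exact/extends_restrict.
exact/(slowly_oscillating_tail_lip x0).
Qed.

Lemma lipschitz_extensionP (u : K) (e d : R) :
  (forall (A : set X) (f : A -> K), ls_lipschitz d d f ->
    exists2 g : X -> K, ls_lipschitz e e g & extends g f) <->
  extendable e d [set: X] (K := K).
Proof.
split=> [ext A f _ fA|ext A f].
  have [g gX gf] := ext A _ ((ls_lipschitz_restrict d A f).2 fA).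
  by exists g; [exact/extends_restrict|exact/ls_lipschitz_setT].
have [F ->] := total_extension u f.
move=> /ls_lipschitz_restrict/(ext A F (@subsetT _ A))[g gF gX].
by exists g; [exact/ls_lipschitz_setT|exact/extends_restrict].
Qed.

End slow_oscillation.

(** * The equivalence, with empty spaces treated apart *)

Theorem corollary4p8 (R : realType) (X K : metricType R) :
  bounded_space K ->
  (ls_absolute_extensor K X <->
   forall e : R, 0 < e -> exists2 d : R, 0 < d &
     forall (A : set X) (f : A -> K), ls_lipschitz d d f ->
       exists2 g : X -> K, ls_lipschitz e e g & extends g f).
Proof.
move=> [M KM].
(* If [X] is empty, both sides hold through the empty map. *)
have [[x0 _]|X0] := pselect (exists x : X, True); last first.
  have elim (x : X) : K by case: X0; exists x.
  have vac (x : X) : False by apply: X0; exists x.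
  split=> [_ e e0|_ A f _].
    exists 1 => // A f _.
    by exists elim => [x|a]; [case: (vac x)|case: (vac (set_val a))].
  by exists elim => [x|a]; [case: (vac x)|case: (vac (set_val a))].
(* If [K] is empty and [X] is not, both sides fail: the map on the empty subset has no extension. *)
have [[u _]|K0] := pselect (exists u : K, True); last first.
  pose f0 (a : set0 : set X) : K := False_rect K (set_valP a).
  have ncontra (g : X -> K) : False by apply: K0; exists (g x0).
  split=> [/(_ set0 f0)[]|/(_ 1 ltr01)[d _ /(_ set0 f0)[]]].
  - by move=> a; case: (set_valP a).
  - by move=> g; case: (ncontra g).
  - by move=> a; case: (set_valP a).
  - by move=> g; case: (ncontra g).
have M0 : 0 <= M by apply: le_trans (KM u u); exact: mdist_ge0.
split=> [/(ls_absolute_extensorP KM M0 x0 u) ext e e0|ext].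
  have [d d0 ed] := @extendable_setT R X K x0 M KM M0 e ext e0.
  by exists d => //; apply/(lipschitz_extensionP u).
apply/(ls_absolute_extensorP KM M0 x0 u) => A f.
apply: (@tail_lip_extension R X K x0 M KM) => e /ext[d d0 ed].
by exists d => //; apply/(lipschitz_extensionP u).
Qed.
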